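(* Fix $\alpha,\beta>0$. For $n\ge3$ let $S$ be a random $\alpha/\beta$-staircase tableau of size $n$ with law $\mathbb{P}_{n,\alpha,\beta}$, and let $A_n^{(3)}$ be the number of boxes $(n-j-1,j)$, $1\le j\le n-2$ (the third main diagonal), that contain $\alpha$. Then, as $n\to\infty$, $A_n^{(3)}$ converges in distribution to a Poisson random variable with parameter $1/2$.
   Context: A staircase tableau of size $n$ has boxes $(i,j)$ with $i,j\ge1$ and $i+j\le n+1$, rows numbered from the top and columns from the left. An $\alpha/\beta$-staircase tableau of size $n$ is a filling in which each box is empty or contains $\alpha$ or $\beta$, such that: all boxes in the same column and above an $\alpha$ are empty; all boxes in the same row and to the left of a $\beta$ are empty; every main-diagonal box (with $i+j=n+1$) contains a symbol. $\overline{\mathcal{S}}_n$ is the set of these. The weight is $wt(S)=\alpha^{N_\alpha}\beta^{N_\beta}$ ($N_\alpha,N_\beta$ the numbers of $\alpha$'s, $\beta$'s), and $\mathbb{P}_{n,\alpha,\beta}(S)=wt(S)/\sum_{T\in\overline{\mathcal{S}}_n}wt(T)$. *)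

(* Defs.v *)
From HB Require Import structures.
From mathcomp Require Import all_boot all_order all_algebra.
From mathcomp Require Import all_classical all_reals all_analysis.
Set Implicit Arguments. Unset Strict Implicit. Unset Printing Implicit Defensive.
Import Order.TTheory GRing.Theory Num.Theory.
Local Open Scope ring_scope.

(* Boxes are indexed 0-based: (i,j) : 'I_n * 'I_n stands for the paper's box
   (i+1, j+1).  The paper's condition i+j <= n+1 (1-based) becomes i+j < n.
   A filling assigns to each box: None = empty, Some true = alpha,
   Some false = beta. *)
Definition filling (n : nat) := {ffun 'I_n * 'I_n -> option bool}.

Definition in_staircase (n : nat) (p : 'I_n * 'I_n) : bool := (p.1 + p.2 < n)%N.
Definition on_main_diag (n : nat) (p : 'I_n * 'I_n) : bool := (p.1 + p.2 == n.-1)%N.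

Definition is_staircase (n : nat) (S : filling n) : bool :=
  [&& [forall p, ~~ in_staircase p ==> (S p == None)],
      [forall i : 'I_n, forall j : 'I_n, (S (i, j) == Some true) ==>
          [forall i' : 'I_n, (i' < i)%N ==> (S (i', j) == None)]],
      [forall i : 'I_n, forall j : 'I_n, (S (i, j) == Some false) ==>
          [forall j' : 'I_n, (j' < j)%N ==> (S (i, j') == None)]] &
      [forall p, on_main_diag p ==> (S p != None)]].

Definition N_alpha (n : nat) (S : filling n) : nat := #|[set p | S p == Some true]|.
Definition N_beta (n : nat) (S : filling n) : nat := #|[set p | S p == Some false]|.

Definition wt {R : realType} (a b : R) (n : nat) (S : filling n) : R :=
  a ^+ N_alpha S * b ^+ N_beta S.

Definition Zn {R : realType} (a b : R) (n : nat) : R :=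
  \sum_(S : filling n | is_staircase S) wt a b S.

Definition Pn {R : realType} (a b : R) (n : nat) (E : pred (filling n)) : R :=
  (\sum_(S : filling n | is_staircase S && E S) wt a b S) / Zn a b n.

(* A_n^(3): number of alpha's on the third main diagonal, i.e. paper's boxes
   (n-j-1, j), 1 <= j <= n-2, i.e. 0-based boxes with i + j = n - 3. *)
Definition A3 (n : nat) (S : filling n) : nat :=
  #|[set p : 'I_n * 'I_n | ((p.1 + p.2)%N == (n - 3)%N) && (S p == Some true)]|.

Definition poisson_cdf {R : realType} (rate : R) (x : R) : R :=
  \sum_(k < (Num.truncn x).+1 | k%:R <= x) poisson_pmf rate k.

(* Main.v *)
Require Import Defs.
From HB Require Import structures.
From mathcomp Require Import all_boot all_order all_algebra.
From mathcomp Require Import all_classical all_reals all_analysis.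
From mathcomp Require Import ring lra zify.
Import Order.TTheory GRing.Theory Num.Theory.
Import numFieldNormedType.Exports.
Local Open Scope classical_set_scope.
Local Open Scope ring_scope.

(* Summing over the first column of a tableau, whose weight depends on the rest only through the number of rows without [beta], replaces [beta] by [beta / (1 + beta)], i.e. it shifts [y = 1 / beta] by 1.  Let [E n y g] be the mean of [g A] for size [n], and let [M = 1 / alpha + y + n], which this shift leaves constant while [n] drops by 1.  Peeling off two more columns when the third-diagonal box of the first column holds [alpha] yields
     E n y g = E (n - 1) (y + 1) g + y / ((M - 1) (M - 2)) (E (n - 3) (y + 1) (g (. + 1) - g) + O(1 / M)).
   Up to O(1 / M), the Poisson mean of [g] with parameter [1/2 - y (y - 1) / (2 (M - 1) (M - 2))] satisfies the same recursion, and for fixed [y] this parameter tends to [1/2]. *)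

Set Implicit Arguments.
Unset Strict Implicit.
Unset Printing Implicit Defensive.

(** * Tableaux as lists of columns *)

Notation empty := (None : option bool).
Notation alpha := (Some true).
Notation beta := (Some false).

(* A tableau is the list of its columns from the left, each read from its main-diagonal box upwards. *)
Definition column := seq (option bool).

(** [fs] records from the bottom which rows are still free, that is, hold no [beta] further right.
    Only a free row may receive a symbol, and an [alpha] empties all boxes above it. *)
Fixpoint fills (fs : seq bool) : seq column :=
  if fs is f :: fs' then
    [seq empty :: c | c <- fills fs'] ++
    (if f then (alpha :: nseq (size fs') empty) :: [seq beta :: c | c <- fills fs'] else [::])
  else [:: [::]].

Definition cols (fs : seq bool) : seq column :=
  (alpha :: nseq (size fs) empty) :: [seq beta :: c | c <- fills fs].

(* The rows without [beta], from the bottom. *)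
Fixpoint flags (T : seq column) : seq bool :=
  if T is c :: T' then
    (head empty c != beta) :: [seq p.1 && (p.2 != beta) | p <- zip (flags T') (behead c)]
  else [::].

(** Deleting the first column of a tableau of size n + 1 leaves one of size n, and the remaining
    columns restrict the deleted one only through [flags]. *)
Fixpoint tabs (n : nat) : seq (seq column) :=
  if n is n'.+1 then [seq c :: T | T <- tabs n', c <- cols (flags T)] else [:: [::]].

(** Heights start at 0 on the main diagonal, so the third diagonal is at height 2. Columns of fewer
    than three boxes read the default [empty] and do not count. *)
Definition diag3 (c : column) : bool := nth empty c 2 == alpha.
Definition A3l (T : seq column) : nat := count diag3 T.

Lemma size_fills fs c : c \in fills fs -> size c = size fs.
Proof.
elim: fs c => [|f fs IH] c /=; first by rewrite inE => /eqP->.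
rewrite mem_cat => /orP[/mapP[d /IH <- ->]//|].
case: f => //; rewrite inE => /orP[/eqP->|/mapP[d /IH <- ->]//].
by rewrite /= size_nseq.
Qed.

Lemma size_cols fs c : c \in cols fs -> size c = (size fs).+1.
Proof.
rewrite inE => /orP[/eqP->|/mapP[d /size_fills <- ->]//].
by rewrite /= size_nseq.
Qed.

Lemma tabsS n S : S \in tabs n.+1 ->
  exists T c, [/\ S = c :: T, T \in tabs n & c \in cols (flags T)].
Proof. by move=> /allpairsPdep[T [c [hT hc ->]]]; exists T, c. Qed.

Lemma size_flags n T : T \in tabs n -> size (flags T) = n.
Proof.
elim: n T => [|n IH] T; first by rewrite inE => /eqP->.
move=> /tabsS[T' [c [-> hT hc]]] /=.
by rewrite size_map size_zip size_behead (size_cols hc) (IH _ hT) /= minnn.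
Qed.

Definition nbeta (c : column) := count (pred1 beta) c.

Lemma count_zip_nseq fs m : size fs = m ->
  [seq p.1 && (p.2 != beta) | p <- zip fs (nseq m empty)] = fs.
Proof. by elim: fs m => [|f fs IH] [|m] //= [/IH->]; rewrite andbT. Qed.

Lemma count_flags_fills fs c : c \in fills fs ->
  (count id [seq p.1 && (p.2 != beta) | p <- zip fs c] + nbeta c)%N = count id fs.
Proof.
elim: fs c => [|f fs IH] c; first by rewrite inE => /eqP->.
rewrite mem_cat => /orP[/mapP[d /IH e ->]/=|].
  by rewrite -e andbT /nbeta /=; lia.
case: f => //; rewrite inE => /orP[/eqP->|/mapP[d /IH e ->]] /=.
  by rewrite count_zip_nseq// /nbeta /= count_nseq /= addn0.
by rewrite -e /nbeta /=; lia.
Qed.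

(** A row holds at most one [beta], so each [beta] removes exactly one of the n rows from the free
    ones. *)
Lemma count_flags n T : T \in tabs n ->
  (count id (flags T) + \sum_(c <- T) nbeta c)%N = n.
Proof.
elim: n T => [|n IH] T; first by rewrite inE => /eqP->; rewrite big_nil.
move=> /tabsS[T' [c [-> hT hc]]] /=; rewrite big_cons -[in RHS](IH _ hT).
move: hc; rewrite inE => /orP[/eqP->|/mapP[d /count_flags_fills e ->]] /=.
  by rewrite count_zip_nseq// /nbeta /= count_nseq /=; lia.
by rewrite -e /nbeta /=; lia.
Qed.

(** * Weights of tableaux and recursions by removing columns *)

Section Weights.
Variable R : comNzRingType.
Implicit Types (al be : R) (g : nat -> R).

Definition wbox al be (x : option bool) : R :=
  if x is Some s then if s then al else be else 1.
Definition wcol al be (c : column) : R := \prod_(x <- c) wbox al be x.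
Definition wtab al be (T : seq column) : R := \prod_(c <- T) wcol al be c.

Definition fdiff g : nat -> R := fun j => g j.+1 - g j.

Definition Htab al be n g : R := \sum_(T <- tabs n) wtab al be T * g (A3l T).

Lemma wcol_cons al be x c : wcol al be (x :: c) = wbox al be x * wcol al be c.
Proof. by rewrite /wcol big_cons. Qed.

Lemma wcol_nseq al be m : wcol al be (nseq m empty) = 1.
Proof. by rewrite /wcol big1_seq// => x /andP[_ /nseqP[-> _]]. Qed.

(** A free row turns the sum S into (1 + be) S + al; any other row leaves it unchanged. The factor
    [be] clears the denominator of the solution, as [R] is only a ring. *)
Lemma sum_fills al be fs :
  be * (\sum_(c <- fills fs) wcol al be c)
  = (al + be) * (1 + be) ^+ count id fs - al.
Proof.
elim: fs => [|f fs IH] /=; first by rewrite big_seq1 /wcol big_nil expr0; ring.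
rewrite big_cat big_map /=.
under eq_bigr do rewrite wcol_cons /= mul1r.
case: f; last by rewrite big_nil addr0 IH.
rewrite big_cons big_map wcol_cons wcol_nseq.
under [X in _ + (_ + X)]eq_bigr do rewrite wcol_cons /=.
rewrite -big_distrr /= add1n exprS.
move: (\sum_(_ <- _) _) IH => S IH.
have -> : be * (S + (al * 1 + be * S)) = (1 + be) * (be * S) + al * be by ring.
by rewrite IH; ring.
Qed.

(** An [alpha] on the diagonal contributes [al], which cancels the [- al] of [sum_fills]. *)
Lemma sum_cols al be fs :
  \sum_(c <- cols fs) wcol al be c = (al + be) * (1 + be) ^+ count id fs.
Proof.
rewrite /cols big_cons big_map wcol_cons wcol_nseq /=.
under eq_bigr do rewrite wcol_cons /=.
by rewrite -big_distrr /= sum_fills; ring.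
Qed.

(** The hypothesis says be' = be / (1 + be) without division; each [beta] then gives up one factor 1
    + be. *)
Lemma wcol_change al be be' c : be' * (1 + be) = be ->
  wcol al be c = wcol al be' c * (1 + be) ^+ nbeta c.
Proof.
move=> h; elim: c => [|x c IH]; first by rewrite /wcol !big_nil mulr1.
rewrite !wcol_cons IH /nbeta /= exprD.
case: x => [[]|] /=; rewrite ?expr0 ?expr1 ?mul1r ?mulrA//.
by rewrite [_ * wcol _ _ _ * (1 + be)]mulrAC h.
Qed.

(** By [count_flags], the free rows and the [beta]s together supply n factors 1 + be, a constant. *)
Lemma wtab_change al be be' n T : be' * (1 + be) = be -> T \in tabs n ->
  wtab al be T * (1 + be) ^+ count id (flags T) = (1 + be) ^+ n * wtab al be' T.
Proof.
move=> h hT; rewrite -[in RHS](count_flags hT) exprD.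
suff -> : wtab al be T = wtab al be' T * (1 + be) ^+ (\sum_(c <- T) nbeta c)%N.
  by ring.
rewrite expr_sum /wtab -big_split /=.
by apply: eq_bigr => c _; apply: wcol_change.
Qed.

Lemma sum_tabsS n (F : seq column -> R) :
  \sum_(S <- tabs n.+1) F S = \sum_(T <- tabs n) \sum_(c <- cols (flags T)) F (c :: T).
Proof. by rewrite -[tabs n.+1]/[seq c :: T | T <- tabs n, c <- cols (flags T)] big_allpairs_dep. Qed.

Lemma sum_tabs_flags al be be' n g : be' * (1 + be) = be ->
  \sum_(T <- tabs n) wtab al be T * (1 + be) ^+ count id (flags T) * g (A3l T)
  = (1 + be) ^+ n * Htab al be' n g.
Proof.
move=> h; rewrite /Htab big_distrr /=.
by apply: eq_big_seq => T hT; rewrite (wtab_change al h hT) mulrA.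
Qed.

Lemma add_bool_fdiff g (e : bool) k : g (e + k)%N = g k + e%:R * fdiff g k.
Proof. by case: e; rewrite /fdiff /= ?mul0r ?addr0 ?mul1r// addrC subrK. Qed.

(** Times [al * be], this is the sum over the tableaux of size n + 1 with [alpha] on the third
    diagonal of the first column, [g] being taken at the count in the other columns. *)
Definition Xtab al be n g : R :=
  \sum_(T <- tabs n) wtab al be T * (1 + (nth false (flags T) 0)%:R * be)
     * (nth false (flags T) 1)%:R * g (A3l T).

(** An [alpha] at height 2 must have no [alpha] below it: the diagonal box holds [beta], and height
    1 is empty or, in a free row, [beta]. Everything above is empty. *)
Lemma sum_cols_diag3 al be fs :
  \sum_(c <- cols fs) wcol al be c * (diag3 c)%:R
  = al * be * (1 + (nth false fs 0)%:R * be) * (nth false fs 1)%:R.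
Proof.
have h1 fs1 : \sum_(c <- fills fs1) wcol al be c * (nth empty c 0 == alpha)%:R
   = al * (nth false fs1 0)%:R.
  case: fs1 => [|f fs1] /=; first by rewrite big_seq1 /= !mulr0.
  rewrite big_cat big_map /= big1 ?add0r; last by move=> *; rewrite mulr0.
  case: f; last by rewrite big_nil mulr0.
  rewrite big_cons big_map big1 /=; last by move=> *; rewrite mulr0.
  by rewrite wcol_cons wcol_nseq /=; ring.
rewrite /cols big_cons big_map /diag3 /= nth_nseq if_same mulr0 add0r.
under eq_bigr do rewrite wcol_cons /= -mulrA.
rewrite -big_distrr /=.
case: fs => [|f fs] /=; first by rewrite big_seq1 /= !mulr0.
rewrite big_cat big_map /=.
under eq_bigr do rewrite wcol_cons /= mul1r.
rewrite h1; case: f; last by rewrite big_nil /=; ring.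
rewrite big_cons big_map /= nth_nseq if_same.
under [X in _ + (_ + X)]eq_bigr do rewrite wcol_cons /= -mulrA.
by rewrite -big_distrr /= h1; ring.
Qed.

(** Write [g] at the new count as [g] plus the indicator of [diag3] times [fdiff g]. The first part
    is summed by [sum_cols] and absorbed into [be']; the second gives [Xtab]. *)
Lemma Htab_rec al be be' n g : be' * (1 + be) = be ->
  Htab al be n.+1 g = (al + be) * (1 + be) ^+ n * Htab al be' n g
                      + al * be * Xtab al be n (fdiff g).
Proof.
move=> h; rewrite /Htab sum_tabsS.
rewrite -mulrA -(sum_tabs_flags al n g h) /Xtab !big_distrr -big_split /=.
apply: eq_bigr => T _.
transitivity (\sum_(c <- cols (flags T)) (wtab al be T * g (A3l T) * wcol al be c
   + wtab al be T * fdiff g (A3l T) * (wcol al be c * (diag3 c)%:R))).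
  apply: eq_bigr => c _.
  by rewrite /wtab big_cons /A3l /= add_bool_fdiff; ring.
by rewrite big_split -!big_distrr /= sum_cols sum_cols_diag3; ring.
Qed.

(* If the bottom row of a tableau is free, its only box holds [alpha], which empties the rest of the first column. *)
Lemma sum_tabs_head_free al be l (F : seq bool -> nat -> R) :
  \sum_(T <- tabs l.+1) wtab al be T * (nth false (flags T) 0)%:R
     * F (behead (flags T)) (A3l T)
  = al * \sum_(T <- tabs l) wtab al be T * F (flags T) (A3l T).
Proof.
rewrite sum_tabsS big_distrr /=; apply: eq_bigr => T _.
rewrite big_cons big_map /= [X in _ + X]big1 ?addr0; last first.
  by move=> c _; rewrite mulr0 mul0r.
rewrite count_zip_nseq// /diag3 /= nth_nseq if_same add0n mulr1.
by rewrite /wtab big_cons wcol_cons wcol_nseq /=; ring.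
Qed.

(** The column starts with [alpha] (weight al (1 + be)), with [beta] and [alpha] (weight al be), or
    with [beta] and an empty box, followed by an arbitrary member of [fills fs]. *)
Lemma sum_cols_Xtab al be f fs k g :
  \sum_(c <- cols (f :: fs)) wcol al be c * (1 + (head empty c != beta)%:R * be)
     * (f && (nth empty c 1 != beta))%:R * g (diag3 c + k)%N
  = f%:R * ((2 * al * be + (al + be) * (1 + be) ^+ count id fs) * g k
      + al * be * (nth false fs 0)%:R * fdiff g k).
Proof.
case: f; last by rewrite mul0r big1// => c _ /=; rewrite mulr0 mul0r.
have h1 : be * \sum_(c <- fills fs) wcol al be c * g ((nth empty c 0 == alpha) + k)%N
   = ((al + be) * (1 + be) ^+ count id fs - al) * g k
     + al * be * (nth false fs 0)%:R * fdiff g k.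
  rewrite -sum_fills.
  case: fs => [|f fs] /=.
    by rewrite !big_seq1 /wcol !big_nil; ring.
  rewrite !big_cat !big_map /=.
  case: f => /=; rewrite ?big_nil.
have e : g (1 + k)%N = g k + fdiff g k by rewrite /fdiff add1n addrC subrK.
    rewrite !big_cons !big_map /= !wcol_cons !wcol_nseq e add0n -!big_distrl /=.
    by ring.
  by rewrite -!big_distrl /=; ring.
rewrite /cols big_cons big_map /= /diag3 /= big_cat big_map /= big_cons big_map.
rewrite !nth_nseq !if_same /= add0n !wcol_cons !wcol_nseq /=.
rewrite [X in _ + (_ + (_ + X))]big1; last by move=> c _; rewrite mulr0 mul0r.
under eq_bigr do rewrite !wcol_cons /= mul1r mul0r addr0 !mulr1 -mulrA.
by rewrite -big_distrr /= h1 nth_nseq if_same add0n; ring.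
Qed.

(** [sum_cols_Xtab] removes one column and leaves the factor saying that the bottom row of the rest
    is free, so [sum_tabs_head_free] removes a second. Only the middle term is of leading order in
    l. *)
Lemma Xtab_rec al be be' l g : be' * (1 + be) = be ->
  Xtab al be l.+2 g = al * (2 * al * be * Htab al be l g
    + (al + be) * (1 + be) ^+ l * Htab al be' l g
    + al * be * \sum_(T <- tabs l) wtab al be T
                  * ((nth false (flags T) 0)%:R * fdiff g (A3l T))).
Proof.
move=> h; rewrite /Xtab sum_tabsS.
pose F fs k := (2 * al * be + (al + be) * (1 + be) ^+ count id fs) * g k
      + al * be * (nth false fs 0)%:R * fdiff g k.
transitivity (\sum_(T <- tabs l.+1) wtab al be T * (nth false (flags T) 0)%:R
     * F (behead (flags T)) (A3l T)).
  apply: eq_big_seq => T hT; have := size_flags hT.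
  case eT: (flags T) => [|f fs]// _.
  rewrite -[RHS]mulrA -sum_cols_Xtab big_distrr /=.
  apply: eq_big_seq => c /size_cols; case: c => [|x [|y c]]// _.
  by rewrite /wtab big_cons /A3l /= eT /=; ring.
rewrite sum_tabs_head_free; congr (_ * _).
rewrite -[(al + be) * _ * _]mulrA -(sum_tabs_flags al l g h) /Htab.
rewrite !big_distrr -!big_split /=.
by apply: eq_bigr => T _; rewrite /F; ring.
Qed.

Lemma Htab_linear al be n (I : eqType) (r : seq I) (P : pred I) (g : I -> nat -> R) :
  Htab al be n (fun j => \sum_(i <- r | P i) g i j) = \sum_(i <- r | P i) Htab al be n (g i).
Proof.
rewrite /Htab exchange_big /=.
by apply: eq_bigr => T _; rewrite big_distrr.
Qed.

Lemma Htab0 al be g : Htab al be 0 g = g 0%N.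
Proof. by rewrite /Htab big_seq1 /wtab big_nil mul1r. Qed.

Lemma eq_Htab al be n g1 g2 : g1 =1 g2 -> Htab al be n g1 = Htab al be n g2.
Proof. by move=> e; apply: eq_bigr => T _; rewrite e. Qed.

Lemma Xtab0 al be g : Xtab al be 0 g = 0.
Proof. by rewrite /Xtab big_seq1 /= mulr0 mul0r. Qed.

Lemma Xtab1 al be g : Xtab al be 1 g = 0.
Proof.
by rewrite /Xtab sum_tabsS big_seq1 /= big_cons big_map big_seq1 /= !mulr0 !mul0r addr0.
Qed.

Lemma Htab1_rec al be be' n : be' * (1 + be) = be ->
  Htab al be n.+1 (fun=> 1) = (al + be) * (1 + be) ^+ n * Htab al be' n (fun=> 1).
Proof.
move=> h; rewrite (Htab_rec _ _ _ h) [X in _ + X](_ : _ = 0) ?addr0//.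
by rewrite /Xtab big1 ?mulr0// => T _; rewrite /fdiff subrr mulr0.
Qed.

End Weights.

(** * Staircase fillings and lists of columns *)

(** Column [j] and height [d] above the main diagonal; the box lies in row [j + d] from the
    bottom. *)
Definition cell (T : seq column) (j d : nat) : option bool := nth empty (nth [::] T j) d.

Lemma fillsP fs c : reflect
  [/\ size c = size fs, forall i, ~~ nth false fs i -> nth empty c i = empty
    & forall i i', (i < i')%N -> nth empty c i = alpha -> nth empty c i' = empty]
  (c \in fills fs).
Proof.
elim: fs c => [|f fs IH] c; apply: (iffP idP).
- rewrite inE => /eqP->; split => // [i|i i'] *; by rewrite nth_nil.
- by case=> /size0nil->.
- rewrite mem_cat => /orP[/mapP[d /IH[h1 h2 h3] ->]|].
    split=> /=; [by rewrite h1|by move=> [|i]//= /h2|].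
    by move=> [|i] [|i']//=; exact: (h3 i i').
  case: f => //; rewrite inE => /orP[/eqP->|/mapP[d /IH[h1 h2 h3] ->]].
    split=> /=; [by rewrite size_nseq|by move=> [|i]//= _; rewrite nth_nseq if_same|].
    by move=> [|i] [|i']//= _; rewrite nth_nseq if_same.
  split=> /=; [by rewrite h1|by move=> [|i]//= /h2|].
  by move=> [|i] [|i']//=; exact: (h3 i i').
- case: c => [[]//|x c] [/= [h1] h2 h3].
  have hc : c \in fills fs.
    apply/IH; split=> // [i hi|i i' ii' hi]; first exact: (h2 i.+1).
    exact: (h3 i.+1 i'.+1).
  rewrite mem_cat; case: x h2 h3 => [s|] h2 h3; last by rewrite map_f.
  have -> : f by apply/negPn/negP => /(h2 0%N).
  case: s h2 h3 => h2 h3; last by rewrite inE map_f ?orbT.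
  rewrite inE; apply/orP; right; apply/orP; left.
  apply/eqP; congr (_ :: _); apply: (@eq_from_nth _ empty); first by rewrite size_nseq.
  by move=> i ic; rewrite nth_nseq if_same; apply: (h3 0%N i.+1).
Qed.

Lemma colsP fs c : reflect
  [/\ size c = (size fs).+1, nth empty c 0 <> empty,
      forall i, ~~ nth false fs i -> nth empty c i.+1 = empty
    & forall i i', (i < i')%N -> nth empty c i = alpha -> nth empty c i' = empty]
  (c \in cols fs).
Proof.
apply: (iffP idP).
  rewrite inE => /orP[/eqP->|/mapP[d /fillsP[h1 h2 h3] ->]].
    split=> //= [|i _|]; [by rewrite size_nseq|by rewrite nth_nseq if_same|].
    by move=> [|i] [|i']//= _; rewrite nth_nseq if_same.
  by split=> //=; [rewrite h1|move=> [|i] [|i']//=; exact: (h3 i i')].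
case: c => [[]//|x c] [/= [h1] hx h2 h3].
case: x hx h3 => [[] _|//] h3.
  rewrite inE; apply/orP; left.
  apply/eqP; congr (_ :: _); apply: (@eq_from_nth _ empty); first by rewrite size_nseq.
  by move=> i ic; rewrite nth_nseq if_same; apply: (h3 0%N i.+1).
rewrite inE map_f ?orbT//; apply/fillsP; split=> // i i' ii'.
exact: (h3 i.+1 i'.+1).
Qed.

Lemma nth_flags n T r : T \in tabs n -> (r < n)%N ->
  nth false (flags T) r <-> (forall j d, (j + d)%N = r -> cell T j d <> beta).
Proof.
elim: n T r => // n IH S r /tabsS[T [c [-> hT hc]]] rn.
have sc := size_cols hc; have sT := size_flags hT.
case: r rn => [|r] rn /=.
  rewrite -nth0; split=> [/eqP h [|j] [|d]//|h].
  by apply/eqP; apply: (h 0%N 0%N).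
rewrite (nth_map (false, empty)); last first.
  by rewrite size_zip size_behead sc sT /= minnn.
rewrite nth_zip; last by rewrite size_behead sc.
rewrite nth_behead; split=> [/andP /=|].
  move=> [/(IH _ _ hT rn) h1 /eqP h2] [|j] d; rewrite ?add0n ?addSn.
    by move=> ->.
  by move=> [] /h1.
move=> h; apply/andP; split; last by apply/eqP; exact: (h 0%N r.+1).
by apply/(IH _ _ hT rn) => j d e; apply: (h j.+1 d); rewrite addSn e.
Qed.

(** The staircase rules in the coordinates of [cell], where boxes of one row share the value of j +
    d. *)
Definition tab_rules n (T : seq column) :=
  [/\ size T = n, forall j, size (nth [::] T j) = (n - j)%N,
      forall j, (j < n)%N -> cell T j 0 <> empty,
      forall j d d', (d < d')%N -> cell T j d = alpha -> cell T j d' = empty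
    & forall j j' d d', (j' < j)%N -> (j' + d' = j + d)%N ->
        cell T j d = beta -> cell T j' d' = empty].

(** Induction on the first column: by [nth_flags], the row rule between it and the rest is exactly
    what [flags] imposes. *)
Lemma tabsP n T : T \in tabs n <-> tab_rules n T.
Proof.
elim: n T => [|n IH] S; split.
- rewrite inE => /eqP->; split=> // *; rewrite /cell ?nth_nil//=.
- by case=> /size0nil->.
- move=> /tabsS[T [c [-> hT hc]]].
  have := hT => /IH[t1 t2 t3 t4 t5]; have sT := size_flags hT.
  have := hc => /colsP[c1 c2 c3 c4].
  split=> /=; first by rewrite t1.
  + by move=> [|j] /=; rewrite ?c1 ?sT.
  + by move=> [|j] // /t3.
  + by move=> [|j] d d' /=; [exact: c4|exact: t4].
  + move=> [//|j] [|j'] d d' jj'; rewrite ?add0n ?addSn; last by move=> [] /t5; apply.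
    move=> -> hb; rewrite /cell /=.
    have [jn|nj] := ltnP (j + d) n; last by rewrite nth_default// c1 sT ltnS.
    by apply: c3; apply/negP => /(nth_flags hT jn) /(_ _ _ erefl).
- case: S => [[]//|c T] [[s1] s2 s3 s4 s5].
  have hT : T \in tabs n.
    apply/IH; split=> //.
    + by move=> j; have := s2 j.+1.
    + by move=> j; have := s3 j.+1.
    + by move=> j; have := s4 j.+1.
    + by move=> j j' d d' h e; apply: (s5 j.+1 j'.+1) => //; rewrite !addSn e.
  apply/allpairsPdep; exists T, c; split=> //; apply/colsP; split.
  + by rewrite (size_flags hT); have := s2 0%N.
  + exact: (s3 0%N).
  + move=> i; have [ni|ni] := leqP n i.
      by move=> _; rewrite nth_default//; have /= -> := s2 0%N.
    move=> /negP hi; apply/eqP/negPn/negP => /eqP hc; apply: hi.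
    apply/(nth_flags hT ni) => j d e hb.
    by apply: hc; apply: (s5 j.+1 0%N d i.+1); rewrite // add0n addSn e.
  + exact: (s4 0%N).
Qed.

Lemma uniq_fills fs : uniq (fills fs).
Proof.
have cons_inj x : injective (cons x : column -> column) by move=> ? ? [].
elim: fs => //= f fs IH; rewrite cat_uniq map_inj_uniq// IH /=.
case: f => //=; rewrite map_inj_uniq// IH andbT negb_or.
apply/andP; split; first apply/andP; try split.
- by apply/mapP => -[].
- by apply/hasPn => c /mapP[d _ ->]; apply/mapP => -[].
- by apply/mapP => -[].
Qed.

Lemma uniq_cols fs : uniq (cols fs).
Proof.
rewrite /= map_inj_uniq ?uniq_fills ?andbT; last by move=> ? ? [].
by apply/mapP => -[].
Qed.

Lemma uniq_tabs n : uniq (tabs n).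
Proof.
elim: n => // n IH; rewrite [tabs _]/[seq c :: T | T <- tabs n, c <- cols (flags T)].
apply: allpairs_uniq_dep => // [T _|]; first exact: uniq_cols.
by move=> [T c] [T' c'] _ _ /= [-> ->].
Qed.

(** * The bijection between staircase fillings and lists of columns *)

Section Encoding.
Variable n : nat.
Implicit Types S : filling n.

Definition box S (i j : nat) : option bool :=
  oapp (fun i' => oapp (fun j' => S (i', j')) empty (insub j)) empty (insub i).

Lemma box_ord S (i j : 'I_n) : box S i j = S (i, j).
Proof. by rewrite /box !valK. Qed.

Definition columns S : seq column :=
  mkseq (fun j => mkseq (fun d => box S (n.-1 - j - d) j) (n - j)) n.

Definition filling_of (T : seq column) : filling n :=
  [ffun p : 'I_n * 'I_n =>
     if in_staircase p then cell T p.2 (n.-1 - p.2 - p.1) else empty].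

Lemma cell_columns S j d :
  cell (columns S) j d = if (j + d < n)%N then box S (n.-1 - j - d) j else empty.
Proof.
rewrite /cell /columns; have [jn|nj] := ltnP j n; last first.
  by rewrite (nth_default [::]) ?size_mkseq// nth_nil ltnNge (leq_trans nj (leq_addr _ _)).
rewrite nth_mkseq//; have [dn|nd] := ltnP d (n - j).
  by rewrite nth_mkseq// -ltn_subRL dn.
by rewrite nth_default ?size_mkseq// ltnNge -leq_subLR nd.
Qed.

Lemma columnsK S : is_staircase S -> filling_of (columns S) = S.
Proof.
move=> /and4P[/forallP h _ _ _]; apply/ffunP => -[i j]; rewrite ffunE /=.
case: ifPn => [|/(implyP (h (i, j)))/eqP->//].
rewrite /in_staircase /= => ij; rewrite cell_columns.
have -> : (j + (n.-1 - j - i) < n)%N by lia.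
have e : (n.-1 - j - (n.-1 - j - i))%N = i by lia.
by rewrite e box_ord.
Qed.

Lemma filling_ofK T : tab_rules n T -> columns (filling_of T) = T.
Proof.
case=> s1 s2 _ _ _; apply: (@eq_from_nth _ [::]); rewrite size_mkseq// => j jn.
rewrite nth_mkseq//.
apply: (@eq_from_nth _ empty); rewrite size_mkseq ?s2// => d dn.
rewrite nth_mkseq//.
have in' : (n.-1 - j - d < n)%N by lia.
have /= -> := box_ord (filling_of T) (Ordinal in') (Ordinal jn).
rewrite ffunE /in_staircase /=.
have -> : (n.-1 - j - d + j < n)%N by lia.
have e : (n.-1 - j - (n.-1 - j - d))%N = d by lia.
by rewrite e.
Qed.

Lemma columns_rules S : is_staircase S -> tab_rules n (columns S).
Proof.
move=> /and4P[/forallP h1 /forallP h2 /forallP h3 /forallP h4].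
have hd j d : (j + d < n)%N -> exists i' j' : 'I_n,
    [/\ (i' = n.-1 - j - d :> nat)%N, (j' = j :> nat)%N & cell (columns S) j d = S (i', j')].
  move=> jd; have in' : (n.-1 - j - d < n)%N by lia.
  have jn : (j < n)%N by lia.
  exists (Ordinal in'), (Ordinal jn); split=> //.
  by rewrite cell_columns jd -box_ord.
split.
- by rewrite size_mkseq.
- move=> j; have [jn|nj] := ltnP j n; first by rewrite nth_mkseq// size_mkseq.
  by rewrite nth_default ?size_mkseq//; apply/esym/eqP; rewrite subn_eq0.
- move=> j jn; have [|i' [j' [ei ej ->]]] := hd j 0%N; first by lia.
  apply/eqP/(implyP (h4 (i', j'))); rewrite /on_main_diag /=; lia.
- move=> j d d' dd'; have [jd'|?] := ltnP (j + d') n; last first.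
    by move=> _; rewrite cell_columns ltnNge; case: ifP => //; lia.
  have [|i1 [j1 [ei ej ->]]] := hd j d; first by lia.
  have [//|i2 [j2 [ei' ej' ->]]] := hd j d'.
  have -> : j2 = j1 by apply/val_inj; rewrite /= ej' ej.
  move=> /eqP/(implyP (forallP (h2 i1) j1))/forallP/(_ i2)/implyP H.
  by apply/eqP/H; lia.
- move=> j j' d d' jj' e; have [jd|?] := ltnP (j + d) n; last first.
    by rewrite cell_columns ltnNge; case: ifP => //; lia.
  have [//|i1 [j1 [ei ej ->]]] := hd j d.
  have [|i2 [j2 [ei' ej' ->]]] := hd j' d'; first by lia.
  have -> : i2 = i1 by apply/val_inj; rewrite /= ei' ei; lia.
  move=> /eqP/(implyP (forallP (h3 i1) j1))/forallP/(_ j2)/implyP H.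
  by apply/eqP/H; lia.
Qed.

Lemma filling_of_staircase T : tab_rules n T -> is_staircase (filling_of T).
Proof.
move=> [_ _ s3 s4 s5]; apply/and4P; split.
- by apply/forallP => p; apply/implyP => /negPf h; rewrite ffunE h.
- apply/forallP => i; apply/forallP => j; apply/implyP; rewrite ffunE.
  case: ifP => //; rewrite /in_staircase /= => ij /eqP ha.
  apply/forallP => i'; apply/implyP => ii'; rewrite ffunE; case: ifP => // _.
  by apply/eqP; apply: s4 ha => /=; lia.
- apply/forallP => i; apply/forallP => j; apply/implyP; rewrite ffunE.
  case: ifP => //; rewrite /in_staircase /= => ij /eqP ha.
  apply/forallP => j'; apply/implyP => jj'; rewrite ffunE; case: ifP => // _.
  by apply/eqP; apply: s5 ha => //=; lia.
- apply/forallP => -[i j]; apply/implyP; rewrite /on_main_diag /= => /eqP ij.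
  have := ltn_ord j; rewrite ffunE /in_staircase /= => jn.
  have -> : (i + j < n)%N by lia.
  have -> : (n.-1 - j - i)%N = 0%N by lia.
  exact/eqP/s3.
Qed.

(** [columns] and [filling_of] are mutually inverse, and neither enumeration repeats an element. *)
Lemma sum_staircase (R : nmodType) (F : seq column -> R) :
  \sum_(S : filling n | is_staircase S) F (columns S) = \sum_(T <- tabs n) F T.
Proof.
have hp : perm_eq (tabs n)
    (map columns (enum (@is_staircase n))).
  apply: uniq_perm; first exact: uniq_tabs.
    rewrite map_inj_in_uniq ?enum_uniq// => S1 S2; rewrite !mem_enum => h1 h2 e.
    by rewrite -(columnsK h1) e columnsK.
  move=> T; apply/idP/mapP => [/tabsP hT|[S0]].
    exists (filling_of T); last by rewrite filling_ofK.
    by rewrite mem_enum; apply: filling_of_staircase.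
  by rewrite mem_enum => hS ->; apply/tabsP/columns_rules.
by rewrite (perm_big _ hp) big_map big_enum.
Qed.

(** Stated for a commutative monoid because it serves both the product of weights and the count on
    the third diagonal. *)
Lemma big_boxes (M : Type) (idx : M) (op : Monoid.com_law idx) (G : nat -> nat -> M) :
  (forall i j, (n <= i + j)%N -> G i j = idx) ->
  \big[op/idx]_(p : 'I_n * 'I_n) G p.1 p.2
  = \big[op/idx]_(0 <= j < n) \big[op/idx]_(0 <= d < n - j) G (n.-1 - j - d)%N j.
Proof.
move=> G0; rewrite -(pair_bigA _ (fun i j : 'I_n => G i j)) exchange_big /=.
rewrite [RHS]big_mkord; apply: eq_bigr => -[j jn] _ /=.
rewrite -(big_mkord xpredT (G^~ j)) (big_cat_nat (n := n - j))//= ?leq_subr//.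
rewrite [X in op _ X]big1_seq ?Monoid.mulm1; last first.
  by move=> i; rewrite mem_index_iota => /andP[_ /andP[hi _]]; apply: G0; lia.
rewrite big_nat_rev; apply: eq_big_nat => d hd.
by congr (G _ _); lia.
Qed.

Lemma box_default S i j : is_staircase S -> (n <= i + j)%N -> box S i j = empty.
Proof.
move=> /and4P[/forallP h _ _ _] nij; rewrite /box.
case: (insubP _ i) => //= i' _ ei; case: (insubP _ j) => //= j' _ ej.
apply/eqP/(implyP (h (i', j'))); rewrite /in_staircase /=.
by rewrite -leqNgt [nat_of_ord i']ei [nat_of_ord j']ej.
Qed.

Lemma wtab_columns (R : realType) (al be : R) S : is_staircase S ->
  wtab al be (columns S) = wt al be S.
Proof.
move=> hS; transitivity (\prod_(p : 'I_n * 'I_n) wbox al be (box S p.1 p.2)).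
  rewrite (@big_boxes _ _ _ (fun i j => wbox al be (box S i j))); last first.
    by move=> i j nij; rewrite box_default.
  rewrite /wtab /columns /mkseq big_map /index_iota subn0; apply: eq_bigr => j _.
  by rewrite /wcol big_map subn0.
under eq_bigr => p _ do rewrite box_ord -surjective_pairing.
rewrite /wt /N_alpha /N_beta -!prodr_const.
rewrite [X in _ = X * _]big_mkcond [X in _ = _ * X]big_mkcond -big_split /=; apply: eq_bigr => p _.
by rewrite !inE; case: (S p) => [[]|] /=; rewrite ?mulr1 ?mul1r.
Qed.

Lemma sum_third m (P : pred nat) :
  (\sum_(0 <= d < m) ((d == 2) && P d) = (2 < m) && P 2)%N.
Proof.
rewrite /index_iota subn0.
case: m => [|[|[|m]]] /=; rewrite ?big_cons ?big_nil//= big1_seq ?addn0// => d.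
by rewrite mem_iota => /andP[_ /andP[d3 _]]; have -> : (d == 2) = false by lia.
Qed.

(** For n < 3 the truncated n - 3 is 0, and [A3] would look at the box (0, 0), which is not on a
    third diagonal. *)
Lemma A3_columns S : (2 < n)%N -> is_staircase S -> A3l (columns S) = A3 S.
Proof.
move=> n3 hS.
transitivity (\sum_(p : 'I_n * 'I_n)
    (((p.1 + p.2)%N == (n - 3)%N) && (box S p.1 p.2 == alpha)))%N.
  rewrite (@big_boxes _ _ _
    (fun i j => nat_of_bool ((i + j == n - 3)%N && (box S i j == alpha)))); last first.
    by move=> i j nij; rewrite box_default// andbF.
  rewrite /A3l -sum1_count big_mkcond /columns /mkseq big_map /index_iota subn0.
  apply: eq_big_seq => j; rewrite mem_iota add0n => /andP[_ jn].
  rewrite -/(index_iota 0 (n - j)).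
  transitivity (\sum_(0 <= d < n - j)
      ((d == 2) && (box S (n.-1 - j - d) j == alpha)))%N; last first.
    apply: eq_big_nat => d hd; congr (nat_of_bool (_ && _)).
    by apply/eqP/eqP; lia.
  rewrite (sum_third _ (fun d => box S (n.-1 - j - d) j == alpha)) /diag3.
  have [j3|j3] := ltnP 2 (n - j).
    by rewrite -/(mkseq _ _) nth_mkseq//=; case: ifP.
  by rewrite nth_default ?size_map ?size_iota.
rewrite /A3 -sum1_card [RHS]big_mkcond /=.
by apply: eq_bigr => p _; rewrite box_ord -surjective_pairing inE; case: ifP.
Qed.

Lemma sum_wt_staircase (R : realType) (al be : R) (g : nat -> R) : (2 < n)%N ->
  \sum_(S : filling n | is_staircase S) wt al be S * g (A3 S) = Htab al be n g.
Proof.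
move=> n3; rewrite /Htab -sum_staircase; apply: eq_bigr => S hS.
by rewrite wtab_columns// A3_columns.
Qed.

End Encoding.

(** * Normalized recursion *)

Section Expectation.
Variables (R : realType) (al : R).
Hypothesis al0 : 0 < al.
Implicit Types (y : R) (g : nat -> R) (n l : nat).

Definition Ztab n y : R := Htab al y^-1 n (fun=> 1).

Definition Etab n y g : R := Htab al y^-1 n g / Ztab n y.

Lemma inv_shift y : 0 < y -> (y + 1)^-1 * (1 + y^-1) = y^-1.
Proof.
move=> y0; have y1 : 0 < y + 1 by lra.
by field; rewrite !gt_eqF.
Qed.

Lemma Ztab_shift n y : 0 < y ->
  Ztab n.+1 y = (al + y^-1) * (1 + y^-1) ^+ n * Ztab n (y + 1).
Proof. by move=> y0; apply: Htab1_rec; apply: inv_shift. Qed.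

(** Induction along the shift of y, which preserves al^-1 + y + n; the extra factor 1 + y^-1 turns
    al / (y + 1) into al / y. *)
Lemma Ztab_ratio n y : 0 < y ->
  Ztab n.+1 y = al / y * (al^-1 + y + n%:R) * Ztab n y.
Proof.
elim: n y => [|n IH] y y0; rewrite (Ztab_shift _ y0).
  rewrite /Ztab !Htab0 expr0 addr0; field; rewrite !gt_eqF//.
have y1 : 0 < y + 1 by lra.
rewrite (IH _ y1) (Ztab_shift _ y0) exprS -natr1.
by field; rewrite !gt_eqF.
Qed.

Lemma Ztab_gt0 n y : 0 < y -> 0 < Ztab n y.
Proof.
move=> y0; elim: n => [|n IH]; first by rewrite /Ztab Htab0.
rewrite Ztab_ratio// !mulr_gt0 ?invr_gt0// ltr_wpDr ?addr_gt0 ?invr_gt0//.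
Qed.

Lemma wtab_ge0 y T : 0 < y -> 0 <= wtab al y^-1 T.
Proof.
move=> y0; apply: prodr_ge0 => c _; apply: prodr_ge0 => -[[]|] _ //=.
  exact: ltW.
by rewrite invr_ge0 ltW.
Qed.

Lemma weighted_mean_le n y (F : seq column -> R) c : 0 < y ->
  (forall T, `|F T| <= c) ->
  `|\sum_(T <- tabs n) wtab al y^-1 T * F T| <= c * Ztab n y.
Proof.
move=> y0 hF; apply: le_trans (ler_norm_sum _ _ _) _.
rewrite /Ztab /Htab big_distrr /=; apply: ler_sum => T _.
rewrite normrM ger0_norm ?wtab_ge0// mulr1 mulrC.
by rewrite ler_wpM2r// wtab_ge0.
Qed.

Lemma Etab_le n y g c : 0 < y -> (forall j, `|g j| <= c) -> `|Etab n y g| <= c.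
Proof.
move=> y0 hg; have Z0 := Ztab_gt0 n y0.
rewrite /Etab normrM normfV (gtr0_norm Z0) ler_pdivrMr//.
exact: weighted_mean_le.
Qed.

Lemma Etab_small n y g : 0 < y -> (n < 3)%N -> Etab n y g = g 0%N.
Proof.
move=> y0 n3; suff e : Htab al y^-1 n g = Ztab n y * g 0%N.
  by rewrite /Etab e mulrAC divff ?mul1r// gt_eqF// Ztab_gt0.
elim: n n3 y y0 => [|n IH] n3 y y0; first by rewrite /Ztab !Htab0 mul1r.
have y1 : 0 < y + 1 by lra.
rewrite (Htab_rec _ _ _ (inv_shift y0)) IH// 1?ltnW//.
case: n {IH} n3 => [|[|//]] _; rewrite ?Xtab0 ?Xtab1 [Ztab _.+1 y]Ztab_shift//; ring.
Qed.

(** The middle term of [Xtab_rec] gives the drift. The other two are smaller by a factor M - 3, and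
    each contributes at most 2 to the constant 4. *)
Lemma Etab_rec l y g M : 0 < y -> (forall j, `|fdiff g j| <= 1) ->
  M = al^-1 + y + l.+3%:R ->
  `|Etab l.+3 y g - Etab l.+2 (y + 1) g
      - y / ((M - 1) * (M - 2)) * Etab l (y + 1) (fdiff g)|
  <= y / ((M - 1) * (M - 2)) * (4 / (M - 3)).
Proof.
move=> y0 hg hM; have y1 : 0 < y + 1 by lra.
have x0 : 0 < al^-1 by rewrite invr_gt0.
have l0 : 0 <= l%:R :> R by exact: ler0n.
have eM : M = al^-1 + y + l%:R + 3.
  by rewrite hM -[in LHS]addn3 natrD addrA.
(* The last term of [Xtab_rec]; the bound 2 comes from the second difference of [g]. *)
pose J := \sum_(T <- tabs l) wtab al y^-1 T
                  * ((nth false (flags T) 0)%:R * fdiff (fdiff g) (A3l T)).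
have hJ : `|J| <= 2 * Ztab l y.
  apply: weighted_mean_le => // T; rewrite normrM normr_nat.
  rewrite -[2]mul1r ler_pM//; first by case: (nth _ _ _).
  rewrite {1}/fdiff (le_trans (ler_normB _ _))//.
  by rewrite (_ : 2 = 1 + 1 :> R)// lerD.
have hE : `|Etab l y (fdiff g)| <= 1 by exact: Etab_le.
have Z0 := Ztab_gt0 l y0; have Z1 := Ztab_gt0 l y1.
have Z2 := Ztab_gt0 l.+2 y1; have Z3 := Ztab_gt0 l.+3 y0.
have eZ1 : Ztab l.+1 y = (al + y^-1) * (1 + y^-1) ^+ l * Ztab l (y + 1).
  exact: Ztab_shift.
have eZ3 : Ztab l.+3 y = (al + y^-1) * (1 + y^-1) ^+ l.+2 * Ztab l.+2 (y + 1).
  exact: Ztab_shift.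
have eZ31 : Ztab l.+3 y = (al / y) ^+ 2 * (M - 1) * (M - 2) * Ztab l.+1 y.
  by rewrite !Ztab_ratio// -!natr1 eM; ring.
have eZ10 : Ztab l.+1 y = al / y * (M - 3) * Ztab l y.
  by rewrite Ztab_ratio// eM; ring.
have -> : Etab l.+3 y g - Etab l.+2 (y + 1) g
      - y / ((M - 1) * (M - 2)) * Etab l (y + 1) (fdiff g)
   = y / ((M - 1) * (M - 2)) / (M - 3) * (2 * Etab l y (fdiff g) + J / Ztab l y).
  have M1 : 0 < M - 1 by lra.
  have M2 : 0 < M - 2 by lra.
  have M3 : 0 < M - 3 by lra.
  have c0 : 0 < al + y^-1 by rewrite addr_gt0 ?invr_gt0.
  have q0 : 0 < 1 + y^-1 by rewrite addr_gt0 ?invr_gt0.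
  rewrite /Etab (Htab_rec _ _ _ (inv_shift y0)) (Xtab_rec _ _ _ (inv_shift y0)) -/J.
  set H1 := Htab _ _ l.+2 _; set H2 := Htab _ _ l _; set H3 := Htab _ _ l _.
  have t1 : H1 / Ztab l.+2 (y + 1) = (al + y^-1) * (1 + y^-1) ^+ l.+2 * H1 / Ztab l.+3 y.
    rewrite eZ3; move: (_ ^+ _) (exprn_gt0 l.+2 q0) (_ + y^-1) c0 => Q Q0 c c0.
    by field; rewrite !gt_eqF.
  have t2 : y / ((M - 1) * (M - 2)) * (H3 / Ztab l (y + 1))
     = al * y^-1 * (al * ((al + y^-1) * (1 + y^-1) ^+ l * H3)) / Ztab l.+3 y.
    rewrite eZ31 eZ1; move: (_ ^+ _) (exprn_gt0 l q0) (_ + y^-1) c0 => Q Q0 c c0.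
    by field; rewrite !gt_eqF.
  have t3 : y / ((M - 1) * (M - 2)) / (M - 3) / Ztab l y
     = al ^+ 3 * y^-1 ^+ 2 / Ztab l.+3 y.
    by rewrite eZ31 eZ10; field; rewrite !gt_eqF.
  have -> : y / ((M - 1) * (M - 2)) / (M - 3) * (2 * (H2 / Ztab l y) + J / Ztab l y)
    = (y / ((M - 1) * (M - 2)) / (M - 3) / Ztab l y) * (2 * H2 + J) by ring.
  by rewrite t1 t2 t3; ring.
have D0 : 0 <= y / ((M - 1) * (M - 2)).
  by rewrite divr_ge0 ?mulr_ge0 ?(ltW y0)//; lra.
have M3 : 0 <= (M - 3)^-1 by rewrite invr_ge0; lra.
rewrite 2!normrM (ger0_norm D0) (ger0_norm M3) -mulrA ler_wpM2l//.
rewrite [X in _ <= X]mulrC ler_wpM2l//.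
apply: le_trans (ler_normD _ _) _.
have hJ' : `|J / Ztab l y| <= 2 by rewrite normrM normfV (gtr0_norm Z0) ler_pdivrMr.
by rewrite normrM normr_nat; lra.
Qed.

Lemma EtabB n y g1 g2 : Etab n y (fun j => g1 j - g2 j) = Etab n y g1 - Etab n y g2.
Proof.
rewrite /Etab -mulrBl; congr (_ / _); rewrite /Htab -sumrB.
by apply: eq_bigr => T _; rewrite mulrBr.
Qed.

End Expectation.

(** * Poisson masses *)

Section Poisson.
Variable R : realType.
Implicit Types (x y M : R) (k : nat).

(* [poisson_fun k.+1] is the Poisson mass at [k] as a function of the parameter; the shift makes the derivative formula uniform in [k]. *)
Definition poisson_fun k x : R :=
  if k is k'.+1 then k'`!%:R^-1 * (x ^+ k' * expR (- x)) else 0.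

Lemma is_derive_poisson_fun k x :
  is_derive x 1 (poisson_fun k.+1) (poisson_fun k x - poisson_fun k.+1 x).
Proof.
have dN : is_derive x 1 (fun z : R => expR (- z)) (- expR (- x)).
  by apply: is_derive_eq; rewrite mulrN1.
have dX : is_derive x 1 (fun z : R => z ^+ k) (k%:R * x ^+ k.-1).
  have := @is_deriveX R R id k x 1 1 _; rewrite exprfctE => h.
  by apply: is_derive_eq; rewrite /GRing.scale/= mulr1.
rewrite /poisson_fun.
have h := is_deriveZ k`!%:R^-1 (is_deriveM dX dN).
apply: (@is_derive_eq _ _ _ _ _ _ _ _ h).
rewrite /GRing.scale /=; case: k {dX h} => [|k] /=; first by rewrite fact0; field.
rewrite factS natrM exprS; field.
by rewrite nat1r !pnatr_eq0 -lt0n fact_gt0.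
Qed.

(** Negative arguments are included because [lam] can fall slightly below 0. *)
Lemma poisson_fun_bound k x : `|x| <= 1 -> `|poisson_fun k x| <= expR 1.
Proof.
case: k => [_|k x1]; first by rewrite normr0 expR_ge0.
rewrite /poisson_fun !normrM (ger0_norm (expR_ge0 _)) -[expR 1]mul1r.
rewrite ler_pM ?mulr_ge0 ?expR_ge0//.
  by rewrite normfV normr_nat invf_le1 ?ltr0n ?fact_gt0// ler1n fact_gt0.
rewrite -[expR 1]mul1r ler_pM ?expR_ge0//.
  by rewrite normrX exprn_ile1.
by rewrite ler_expR; move: x1; rewrite ler_norml; lra.
Qed.

Lemma poisson_fun_MVT k x y : x <= y -> exists2 z, x <= z <= y &
  poisson_fun k.+1 y - poisson_fun k.+1 x
  = (poisson_fun k z - poisson_fun k.+1 z) * (y - x).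
Proof.
move=> xy.
have [z zxy ->] := @MVT_segment _ (poisson_fun k.+1)
  (fun z => poisson_fun k z - poisson_fun k.+1 z) _ _ xy
  (fun z _ => is_derive_poisson_fun k z)
  (derivable_within_continuous (fun z _ => @ex_derive _ _ _ _ _ _ _ (is_derive_poisson_fun k z))).
by exists z; rewrite // -in_itv/=.
Qed.

Lemma poisson_fun_lip k x y : `|x| <= 1 -> `|y| <= 1 ->
  `|poisson_fun k x - poisson_fun k y| <= 2 * expR 1 * `|x - y|.
Proof.
case: k => [_ _|k]; first by rewrite subrr normr0 mulr_ge0// mulr_ge0// expR_ge0.
wlog xy : x y / y <= x.
  move=> H x1 y1; have [yx|/ltW xy] := leP y x; first exact: H.
  by rewrite distrC [`|x - y|]distrC; apply: H.
move=> x1 y1; have [z zxy ->] := poisson_fun_MVT k xy.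
have z1 : `|z| <= 1 by move: x1 y1; rewrite !ler_norml; lra.
rewrite normrM ler_wpM2r// (le_trans (ler_normB _ _))//.
by rewrite mulrDl mul1r lerD// poisson_fun_bound.
Qed.

(** The mean value theorem gives the derivative at some t in [x, y]; moving it to z costs two
    Lipschitz bounds, each 2 e d. *)
Lemma poisson_fun_step k x y z d : `|x| <= 1 -> `|y| <= 1 -> `|z| <= 1 -> x <= y ->
  (forall t, x <= t <= y -> `|t - z| <= d) ->
  `|poisson_fun k.+1 y - poisson_fun k.+1 x
    - (y - x) * (poisson_fun k z - poisson_fun k.+1 z)| <= (y - x) * (4 * expR 1 * d).
Proof.
move=> x1 y1 z1 xy hd; have [t txy ->] := poisson_fun_MVT k xy.
have t1 : `|t| <= 1 by move: x1 y1; rewrite !ler_norml; lra.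
rewrite [X in X - _]mulrC -mulrBr normrM ger0_norm ?subr_ge0// ler_wpM2l ?subr_ge0//.
have -> : poisson_fun k t - poisson_fun k.+1 t - (poisson_fun k z - poisson_fun k.+1 z)
  = (poisson_fun k t - poisson_fun k z) - (poisson_fun k.+1 t - poisson_fun k.+1 z) by ring.
apply: le_trans (ler_normB _ _) _.
have h := hd _ txy; have c0 := expR_ge0 (1 : R).
have := poisson_fun_lip k t1 z1; have := poisson_fun_lip k.+1 t1 z1.
by have := ler_wpM2l c0 h; lra.
Qed.

(** The drift coefficients telescope to y (y - 1) / 2 over (M - 1) (M - 2). The constant 1/2 makes
    the value nearly 0 at y close to M, where the tableau is too small for a third diagonal. *)
Definition lam M y : R := 2^-1 - y * (y - 1) / (2 * ((M - 1) * (M - 2))).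

Lemma lamS M y : 10 <= M -> lam M y - lam M (y + 1) = y / ((M - 1) * (M - 2)).
Proof.
move=> M10; have M1 : 0 < M - 1 by lra.
have M2 : 0 < M - 2 by lra.
by rewrite /lam; field; rewrite !gt_eqF.
Qed.

Lemma lam_step M y : 10 <= M -> 0 < y <= M - 3 ->
  0 <= y / ((M - 1) * (M - 2)) <= 1 / M.
Proof.
move=> M10 hy; rewrite divr_ge0 ?mulr_ge0 /=; try lra.
(* The bound rests on M (M - 3) <= (M - 1) (M - 2). *)
rewrite ler_pdivrMr ?mulr_gt0; try lra.
by rewrite mul1r mulrC ler_pdivlMr; nra.
Qed.

(** Size l at y + 1 belongs to the line M - 2, so its parameter must be compared with the one on the
    line M. *)
Lemma lam_dist M y : 10 <= M -> 0 < y <= M - 3 ->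
  `|lam M (y + 1) - lam (M - 2) (y + 1)| <= 4 / M.
Proof.
move=> M10 hy.
have M1 : 0 < M - 1 by lra.
have M2 : 0 < M - 2 by lra.
have M3 : 0 < M - 3 by lra.
have M4 : 0 < M - 4 by lra.
have -> : lam M (y + 1) - lam (M - 2) (y + 1)
  = (y + 1) * y / ((M - 2) * (M - 3)) * ((2 * M - 5) / ((M - 1) * (M - 4))).
  rewrite /lam; field; rewrite -?addrA -?opprD !gt_eqF//; lra.
have h1 : 0 <= (y + 1) * y / ((M - 2) * (M - 3)) <= 1.
  rewrite divr_ge0 ?mulr_ge0 /=; try lra.
  by rewrite ler_pdivrMr ?mulr_gt0// mul1r; nra.
have h2 : 0 <= (2 * M - 5) / ((M - 1) * (M - 4)) <= 4 / M.
  rewrite divr_ge0 ?mulr_ge0 /=; try lra.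
  rewrite ler_pdivrMr ?mulr_gt0// mulrAC ler_pdivlMr; last lra.
  by nra.
case/andP: h1 => h10 h11; case/andP: h2 => h20 h21.
rewrite ger0_norm; last exact: mulr_ge0.
by rewrite -[4 / M]mul1r; apply: ler_pM.
Qed.

(** The subtracted fraction is at most M / (2 (M - 2)), which is 5/8 at M = 10. *)
Lemma lam_bounds M y : 10 <= M -> 0 < y <= M -> - (8^-1) <= lam M y <= 1.
Proof.
move=> M10 hy; rewrite /lam.
set q := _ / _; suff : - (2^-1) <= q <= 2^-1 + 8^-1 by lra.
have M12 : 0 < 2 * ((M - 1) * (M - 2)) by rewrite !mulr_gt0; lra.
by rewrite /q ler_pdivlMr// ler_pdivrMr//; apply/andP; split; nra.
Qed.

Lemma lam_le M y : 10 <= M -> 0 < y -> lam M (y + 1) <= 2^-1.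
Proof.
move=> M10 y0; rewrite /lam gerBl divr_ge0 ?mulr_ge0; lra.
Qed.

(** After substituting y = M - d the terms in M squared cancel from the numerator. *)
Lemma lam_small x M y d : 10 <= M -> 0 < y -> 0 <= d <= x + 2 -> M = y + d ->
  `|lam M y| <= (4 * x + 12) / M.
Proof.
move=> M10 y0 hd eM; have M12 : 0 < 2 * ((M - 1) * (M - 2)) by rewrite !mulr_gt0; lra.
have -> : lam M y = ((2 * d - 2) * M + 2 - d ^+ 2 - d) / (2 * ((M - 1) * (M - 2))).
  have -> : y = M - d by lra.
  rewrite /lam; field; rewrite !gt_eqF//; lra.
rewrite normrM normfV (gtr0_norm M12) ler_pdivrMr// mulrAC ler_pdivlMr; last lra.
have h : `|(2 * d - 2) * M + 2 - d ^+ 2 - d| <= (4 * d + 4) * M.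
  by rewrite ler_norml; apply/andP; split; nra.
apply: le_trans (ler_wpM2r _ h) _; first lra.
have hM : M * M <= 2 * ((M - 1) * (M - 2)) by nra.
have h4 : 0 <= 4 * d + 4 by lra.
have hd4 : 4 * d + 4 <= 4 * x + 12 by lra.
by have := ler_wpM2l h4 hM; have := ler_wpM2r (ltW M12) hd4; lra.
Qed.

Lemma lam_half M y : 10 <= M -> 0 < y -> `|lam M y - 2^-1| <= (y ^+ 2 + y) / M.
Proof.
move=> M10 y0; have M12 : 0 < 2 * ((M - 1) * (M - 2)) by rewrite !mulr_gt0; lra.
rewrite /lam addrAC subrr add0r normrN normrM normfV (gtr0_norm M12).
have h : `|y * (y - 1)| <= y ^+ 2 + y by rewrite ler_norml; apply/andP; split; nra.
rewrite ler_pM ?invr_ge0 ?(ltW M12)// lef_pV2 ?posrE//; nra.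
Qed.

End Poisson.

(** * Convergence *)

Section Limit.
Variables (R : realType) (al : R).
Hypothesis al0 : 0 < al.
Implicit Types (y M : R) (k n : nat).

(** The index is shifted as in [poisson_fun], so that [fdiff_delta] mirrors the derivative formula
    for every k. *)
Definition delta_fun k (j : nat) : R := (j.+1 == k)%:R.

Lemma fdiff_delta k : fdiff (delta_fun k.+1) =1 (fun j => delta_fun k j - delta_fun k.+1 j).
Proof. by move=> j; rewrite /fdiff /delta_fun !eqSS. Qed.

Lemma fdiff_delta_le k j : `|fdiff (delta_fun k) j| <= 1.
Proof.
rewrite /fdiff /delta_fun ler_norml.
by case: eqP => _; case: eqP => _ /=; apply/andP; split; lra.
Qed.

Lemma Etab_delta0 n y : Etab al n y (delta_fun 0) = 0.
Proof.
by rewrite /Etab /Htab big1 ?mul0r// => T _; rewrite /delta_fun mulr0.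
Qed.

Lemma Etab_delta_le n y k : 0 < y -> `|Etab al n y (delta_fun k)| <= 1.
Proof.
move=> y0; apply: Etab_le => // j.
by rewrite /delta_fun normr_nat lern1 leq_b1.
Qed.

(* The induction closes because the drift coefficients along a line of constant [M] sum to at most [1/2], and the factor [8 ^+ k] makes the contribution of [k] to [k.+1] small. *)
Lemma Etab_poisson : exists2 K : R, 0 <= K & forall n k y M, 0 < y ->
  M = al^-1 + y + n%:R -> 10 <= M ->
  `|Etab al n y (delta_fun k) - poisson_fun k (lam M y)|
  <= 8 ^+ k * (K / M) * (4^-1 + lam M y).
Proof.
set c := expR (1 : R); have c1 : 1 <= c by rewrite /c -expR0 ler_expR.
set x := al^-1; have x0 : 0 < x by rewrite invr_gt0.
set K0 := 2 * c * (4 * x + 12).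
have K00 : 0 <= K0 by rewrite /K0 !mulr_ge0; lra.
(* As 1/4 + lam is at least 1/8, the term with 448 = 8 * 56 covers M <= 56, and [K0] covers n <
   3. *)
exists (448 * (1 + c) + K0); first lra.
set K := _ + K0.
elim/ltn_ind => n IH k y M y0 eM M10.
have n0 : 0 <= n%:R :> R by exact: ler0n.
have hyM : 0 < y <= M by lra.
have /andP[la lb] := lam_bounds M10 hyM.
have ln1 : `|lam M y| <= 1 by rewrite ler_norml; lra.
have M0 : 0 < M by lra.
have KM : 0 <= K / M by rewrite divr_ge0 /K; lra.
have A0 : 1 <= 8 ^+ k :> R by rewrite exprn_ege1//; lra.
have AKM : 0 <= 8 ^+ k * (K / M) by rewrite mulr_ge0//; lra.
case: k A0 AKM => [|k] A0 AKM.
  by rewrite Etab_delta0 /= subrr normr0 mulr_ge0//; lra.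
have hQ : `|poisson_fun k.+1 (lam M y)| <= c by exact: poisson_fun_bound.
(* Beyond 56, M / (M - 2) is at most 28/27. *)
have [M56|M56] := leP M 56.
  have hE := Etab_delta_le n k.+1 y0.
  apply: (@le_trans _ _ (1 + c)); first by rewrite (le_trans (ler_normB _ _))// lerD.
  have h1 : 8 * (1 + c) <= K / M by rewrite ler_pdivlMr// /K; nra.
  have h2 : K / M <= 8 ^+ k.+1 * (K / M) by rewrite ler_peMl.
  by nra.
have A8 : 8 <= 8 ^+ k.+1 :> R by rewrite exprS ler_peMr ?exprn_ege1//; lra.
have [n3|] := ltnP n 3.
  have n2 : n%:R <= 2 :> R by rewrite ler_nat -ltnS.
  have hl : `|lam M y| <= (4 * x + 12) / M.
    by apply: (@lam_small _ _ _ _ (x + n%:R)) => //; lra.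
  (* The count is 0 for n < 3, which is the Poisson law of parameter 0. *)
  have -> : Etab al n y (delta_fun k.+1) = poisson_fun k.+1 0.
    rewrite Etab_small// /delta_fun /poisson_fun oppr0 expR0 mulr1.
    by case: k {hQ A0 AKM A8} => [|k]; rewrite ?fact0 ?invr1 ?mulr1 ?expr0// exprS mul0r mulr0.
  have z1 : `|0 : R| <= 1 by rewrite normr0.
  apply: le_trans (poisson_fun_lip k.+1 z1 ln1) _; rewrite sub0r normrN -/c.
  have c20 : 0 <= 2 * c by lra.
  apply: (@le_trans _ _ (K0 / M)).
    by rewrite /K0 -[X in _ <= X]mulrA ler_wpM2l.
  have h1 : K0 / M <= K / M by rewrite ler_pM2r ?invr_gt0// /K; lra.
  have h2 : 8 * (K / M) <= 8 ^+ k.+1 * (K / M) by rewrite ler_wpM2r.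
  by nra.
case: n IH eM n0 => [|[|[|l]]]// IH eM _ _.
have l0 : 0 <= l%:R :> R by exact: ler0n.
have el : l.+3%:R = l%:R + 3 :> R by rewrite -addn3 natrD.
have el2 : l.+2%:R = l%:R + 2 :> R by rewrite -addn2 natrD.
have hy3 : 0 < y <= M - 3 by lra.
have y1 : 0 < y + 1 by lra.
have /andP[D0 D1] := lam_step M10 hy3.
have eD := lamS y M10.
have hd := lam_dist M10 hy3.
have hrec := Etab_rec al0 y0 (fdiff_delta_le k.+1) eM.
set D := y / _ in D0 D1 eD hrec.
have hz : 0 < y + 1 <= M - 2 by lra.
have M210 : 10 <= M - 2 by lra.
have hz' : 0 < y + 1 <= M by lra.
have /andP[la' lb'] := lam_bounds M10 hz'.
have /andP[la'' lb''] := lam_bounds M210 hz.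
have lh := lam_le M210 y0.
have IH1 := IH l.+2 (leqnn _) k.+1 _ M y1 ltac:(lra) M10.
have IH2 := IH l (leqW (leqnSn _)) k _ (M - 2) y1 ltac:(lra) M210.
have IH3 := IH l (leqW (leqnSn _)) k.+1 _ (M - 2) y1 ltac:(lra) M210.
have eF : Etab al l (y + 1) (fdiff (delta_fun k.+1))
    = Etab al l (y + 1) (delta_fun k) - Etab al l (y + 1) (delta_fun k.+1).
  by rewrite -EtabB /Etab; congr (_ / _); apply: eq_Htab; apply: fdiff_delta.
rewrite eF in hrec.
move: IH1 IH2 IH3 hrec.
set E1 := Etab _ l.+2 _ _; set F0 := Etab _ l _ (delta_fun k).
set F1 := Etab _ l _ (delta_fun k.+1); set E := Etab _ l.+3 _ _.
set l1 := lam M (y + 1) in hd eD la' lb' *.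
set l2 := lam (M - 2) (y + 1) in hd lh la'' lb'' *.
set l0' := lam M y in la lb ln1 hQ eD *.
move=> IH1 IH2 IH3 hrec.
(* The distance 5 / M is 4 / M from [lam_dist] plus 1 / M from [lam_step]. *)
have hs : `|poisson_fun k.+1 l0' - poisson_fun k.+1 l1
    - (l0' - l1) * (poisson_fun k l2 - poisson_fun k.+1 l2)|
    <= (l0' - l1) * (4 * c * (5 / M)).
  apply: poisson_fun_step => //; try by rewrite ler_norml; lra.
    by rewrite -subr_ge0 eD.
  move=> t ht; have -> : 5 / M = 4 / M + 1 / M by ring.
  have -> : t - l2 = (l1 - l2) + (t - l1) by ring.
  by apply: le_trans (ler_normD _ _) _; apply: lerD => //; rewrite ger0_norm; lra.
rewrite eD in hs.
have M20 : 0 < M - 2 by lra.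
have M30 : 0 < M - 3 by lra.
set A := 8 ^+ k.+1 in A0 AKM A8 IH1 IH3 *.
have eA : 8 ^+ k = A / 8 by rewrite /A exprS; field.
rewrite eA in IH2.
have K0' : 0 <= K by rewrite /K; lra.
have hK8 : 8 + 20 * c <= K by rewrite /K; lra.
have i3 : 4 / (M - 3) <= 8 / M.
  by rewrite ler_pdivrMr// mulrAC ler_pdivlMr//; clear - M56; lra.
have hKM2 : K / (M - 2) <= 28 / 27 * (K / M).
  have -> : 28 / 27 * (K / M) = K * (28 / 27 / M) by ring.
  rewrite ler_wpM2l// ler_pdivlMr// mulrC ler_pdivrMr//; clear - M56; lra.
have l2b : 0 <= 4^-1 + l2 <= 3 / 4 by clear - la'' lh; lra.
have KM2 : 0 <= K / (M - 2) by rewrite divr_ge0// ltW.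
(* Since [l2] is at most 1/2, the factor is 28/27 * 3/4 = 7/9. *)
have bound2 (B : R) : 0 <= B ->
    B * (K / (M - 2)) * (4^-1 + l2) <= B * (K / M) * (7 / 9).
  move=> B0; have /andP[l20 l21] := l2b.
  have -> : B * (K / M) * (7 / 9) = B * (28 / 27 * (K / M)) * (3 / 4) by field; rewrite gt_eqF.
  by apply: ler_pM => //; [exact: mulr_ge0|exact: ler_wpM2l].
have A00 : 0 <= A by clear - A0; lra.
have A80 : 0 <= A / 8 by rewrite divr_ge0.
have B2 := le_trans IH2 (bound2 _ A80).
have B3 := le_trans IH3 (bound2 _ A00).
(* Raising [l1] by D allows D * A * (K / M). The two terms of size l use (1 + 1/8) * 7/9 = 7/8 of
   it; the remaining 1/8 pays for the errors of the recursion and of the derivative. *)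
have main : 8 / M + 4 * c * (5 / M) <= A * (K / M) / 8.
  have -> : 8 / M + 4 * c * (5 / M) = (8 + 20 * c) / M by ring.
  have h1 : (8 + 20 * c) / M <= K / M by rewrite ler_pM2r ?invr_gt0.
  have h2 : 8 * (K / M) <= A * (K / M) by rewrite ler_wpM2r.
  by clear - h1 h2; lra.
have -> : E - poisson_fun k.+1 l0' = (E - E1 - D * (F0 - F1)) + (E1 - poisson_fun k.+1 l1)
   + D * ((F0 - poisson_fun k l2) - (F1 - poisson_fun k.+1 l2))
   - (poisson_fun k.+1 l0' - poisson_fun k.+1 l1 - D * (poisson_fun k l2 - poisson_fun k.+1 l2)).
  by ring.
apply: (@le_trans _ _ (D * (8 / M) + A * (K / M) * (4^-1 + l1)
    + D * (A * (K / M) * (7 / 8)) + D * (4 * c * (5 / M)))).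
  apply: le_trans (ler_normB _ _) _; apply: lerD => //.
  apply: le_trans (ler_normD _ _) _; apply: lerD.
    apply: le_trans (ler_normD _ _) _; apply: lerD => //.
    by apply: le_trans hrec _; rewrite ler_wpM2l.
  rewrite normrM (ger0_norm D0) ler_wpM2l// (le_trans (ler_normB _ _))//.
  by apply: le_trans (lerD B2 B3) _; clear - AKM; lra.
have -> : l0' = l1 + D by rewrite -eD addrC subrK.
rewrite -subr_ge0.
have -> : A * (K / M) * (4^-1 + (l1 + D)) - (D * (8 / M) + A * (K / M) * (4^-1 + l1)
    + D * (A * (K / M) * (7 / 8)) + D * (4 * c * (5 / M)))
  = D * (A * (K / M) / 8 - (8 / M + 4 * c * (5 / M))).
  by field; rewrite gt_eqF.
by rewrite mulr_ge0// subr_ge0.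
Qed.

Lemma Etab_cvg k y : 0 < y ->
  (fun n => Etab al n y (delta_fun k)) @ \oo --> poisson_fun k (2^-1).
Proof.
move=> y0; have [K K0 hK] := Etab_poisson.
(* The first summand bounds 1/4 + lam by 2; the second is the Lipschitz bound applied to
   [lam_half]. *)
pose C := 8 ^+ k * K * 2 + 2 * expR 1 * (y ^+ 2 + y).
have C0 : 0 <= C.
  have A0 : 0 <= 8 ^+ k :> R by exact: exprn_ge0.
  by rewrite addr_ge0// mulr_ge0// ?mulr_ge0 ?expR_ge0// addr_ge0 ?sqr_ge0// ltW.
have x0 : 0 < al^-1 by rewrite invr_gt0.
apply/cvgrPdist_le => e e0; near=> n.
set M := al^-1 + y + n%:R.
have n10 : 10 <= n%:R :> R by near: n; exact: nbhs_infty_ger.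
have nC : C / e <= n%:R by near: n; exact: nbhs_infty_ger.
have M10 : 10 <= M by rewrite /M; lra.
have MC : C / M <= e.
  rewrite ler_pdivrMr; last lra.
  by move: nC; rewrite ler_pdivrMr// /M; nra.
rewrite distrC; apply: le_trans MC.
have hyM : 0 < y <= M by rewrite /M; lra.
have /andP[la lb] := lam_bounds M10 hyM.
have h := hK n k y M y0 erefl M10.
have l1 : `|lam M y| <= 1 by rewrite ler_norml; lra.
have h1 : `|2^-1 : R| <= 1 by rewrite ger0_norm; lra.
have hl := poisson_fun_lip k l1 h1.
have hh := lam_half M10 y0.
rewrite -[_ - _](subrKA (poisson_fun k (lam M y))).
apply: le_trans (ler_normD _ _) _.
have -> : C / M = 8 ^+ k * (K / M) * 2 + 2 * expR 1 * ((y ^+ 2 + y) / M) by rewrite /C; ring.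
apply: lerD.
  apply: le_trans h _; rewrite ler_wpM2l; try lra.
  by rewrite mulr_ge0 ?exprn_ge0 ?divr_ge0//; lra.
by apply: le_trans hl _; rewrite ler_wpM2l// mulr_ge0 ?expR_ge0.
Unshelve. all: by end_near. Qed.

End Limit.

(* Convergence in distribution of A_n^(3) to Poisson(1/2): the distribution
   functions P_n(A_n^(3) <= x) converge to the Poisson(1/2) distribution
   function at every continuity point x of the latter. *)
Theorem theorem4p3 (R : realType) (a b : R) (ha : 0 < a) (hb : 0 < b) :
  forall x : R, {for x, continuous (poisson_cdf (1 / 2 : R))} ->
    (fun n : nat => Pn a b (fun S : filling n => (A3 S)%:R <= x))
      @ \oo --> poisson_cdf (1 / 2 : R) x.
Proof.
move=> x _; rewrite /poisson_cdf.
(* The indicator of j <= x is a finite sum of [delta_fun]s; for negative x the condition k <= x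
   leaves an empty sum. *)
have hx (j : nat) : (j%:R <= x)%R%:R
    = \sum_(k < (Num.truncn x).+1 | k%:R <= x) delta_fun R k.+1 j.
  rewrite big_mkcond /=; case: (boolP (j%:R <= x)) => jx; last first.
    rewrite big1// => k _; case: ifP => // kx; rewrite /delta_fun eqSS.
    by case: eqP => // e; rewrite e kx in jx.
  have jt : (j < (Num.truncn x).+1)%N by rewrite ltnS truncn_ge_nat// (le_trans _ jx).
  rewrite (bigD1 (Ordinal jt))//= jx /delta_fun eqxx big1 ?addr0// => k kj.
  by case: ifP => // _; rewrite eqSS; case: eqP => // e; rewrite -val_eqE /= e eqxx in kj.
have hb' : 0 < b^-1 by rewrite invr_gt0.
apply: (@cvg_trans _ ((fun n => \sum_(k < (Num.truncn x).+1 | k%:R <= x)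
    Etab a n b^-1 (delta_fun R k.+1)) @ \oo)); last first.
  have -> : \sum_(k < (Num.truncn x).+1 | k%:R <= x) poisson_pmf (1 / 2) k
      = \sum_(k < (Num.truncn x).+1 | k%:R <= x) poisson_fun k.+1 (2^-1 : R).
    apply: eq_bigr => k _; rewrite /poisson_pmf /poisson_fun divr_gt0// div1r.
    by rewrite [RHS]mulrA [_ * _ ^+ _]mulrC.
  by apply: (cvg_big add_continuous) => k _; exact: Etab_cvg.
apply: near_eq_cvg; near=> n.
(* From size 3 on, fillings and lists of columns give the same sums, so the two sequences agree
   eventually. *)
have n3 : (2 < n)%N by near: n; exact: nbhs_infty_gt.
have eZ : Zn a b n = Ztab a n b^-1.
  rewrite /Zn /Ztab invrK -sum_wt_staircase//.
  by apply: eq_bigr => S _; rewrite mulr1.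
rewrite /Pn /Etab -mulr_suml eZ; congr (_ / _).
rewrite -Htab_linear invrK -sum_wt_staircase//.
rewrite [LHS]big_mkcond [RHS]big_mkcond; apply: eq_bigr => S _ /=; rewrite -hx.
by case: (is_staircase S); case: (_ <= x); rewrite /= ?mulr1 ?mulr0.
Unshelve. all: by end_near. Qed.
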